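(* For every $\varepsilon>0$ and $k\in\mathbb{N}$ there exists $C=C(\varepsilon,k)>0$ such that the following holds for every $\ell\in[k-1]$ and every sufficiently large $n$. Let $L\in\binom{[k]}{\ell}$ and let $H$ be a $k$-partite $k$-graph with parts $V_1\cup\dots\cup V_k=V(H)$ such that $|V_i|=n$ for each $i\in[k]$. If $$\delta_L(H)n^{\ell}+\delta_{[k]\setminus L}(H)n^{k-\ell}\ge(1+\varepsilon)n^k,$$ then there is a $(C/n)$-vertex-spread distribution on embeddings of perfect matchings into $H$.
   Context: A $k$-partite $k$-graph $H$ with parts $V_1,\dots,V_k$ has every edge meeting each $V_i$ in exactly one vertex. For $X\subseteq V(H)$ let $N(X)=\{Y\subseteq V(H)\setminus X: X\cup Y\in E(H)\}$. For $L\subseteq[k]$, $\delta_L(H)$ is the minimum of $|N(X)|$ over all sets $X\subseteq V(H)$ with $|X|=|L|$ and $|X\cap V_i|=1$ for each $i\in L$. An embedding $\varphi:G\hookrightarrow H$ of a hypergraph $G$ into $H$ is an injection $V(G)\to V(H)$ mapping edges of $G$ to edges of $H$; ''embeddings of perfect matchings into $H$'' means embeddings of the $k$-graph consisting of $n$ vertex-disjoint edges (on $kn$ vertices). For $q\in[0,1]$, a probability distribution $\mu$ on such embeddings is $q$-vertex-spread if for every two sequences of distinct vertices $x_1,\dots,x_r\in V(G)$ and distinct $y_1,\dots,y_r\in V(H)$, $\mu(\{\varphi:\varphi(x_i)=y_i\ \forall i\in[r]\})\le q^r$. *)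

(* Defs.v *)
From mathcomp Require Import all_boot all_order all_algebra.
From mathcomp Require Import reals.

Set Implicit Arguments.
Unset Strict Implicit.
Unset Printing Implicit Defensive.

Import Order.TTheory GRing.Theory Num.Theory.
Local Open Scope ring_scope.

(* A hypergraph on V is identified with its set of edges. *)
Definition hypergraph (V : finType) := {set {set V}}.

Section Degrees.
Local Open Scope nat_scope.
Variable V : finType.
Implicit Types (H : hypergraph V) (X : {set V}).

Definition nbhd H X : {set {set V}} :=
  [set Y : {set V} | (Y \subset ~: X) && (X :|: Y \in H)].

(* Uniformity is not a separate field: an edge has exactly k vertices because
   it has one in each of the k classes, which partition V. *)
Record kpartite (k : nat) (P : 'I_k -> {set V}) H : Prop := Kpartite {
  parts_disjoint : forall i j, i != j -> [disjoint P i & P j];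
  parts_cover : \bigcup_i P i = [set: V];
  edge_transversal : forall e, e \in H -> forall i, #|e :&: P i| = 1
}.

Definition legal_set (k : nat) (P : 'I_k -> {set V}) (L : {set 'I_k}) X :=
  (#|X| == #|L|) && [forall i in L, #|X :&: P i| == 1].

(* The default value #|H| is neutral: Y |-> X :|: Y injects nbhd H X into H,
   so this is the usual minimum as soon as some legal X exists. *)
Definition min_degree (k : nat) (P : 'I_k -> {set V}) H (L : {set 'I_k}) : nat :=
  \big[minn/#|H|]_(X | legal_set P L X) #|nbhd H X|.

Lemma card_nbhd_le H X : #|nbhd H X| <= #|H|.
Proof.
have inj : {in nbhd H X &, injective (fun Y => X :|: Y)}.
  have dif Y : Y \in nbhd H X -> (X :|: Y) :\: X = Y.
    rewrite inE => /andP[sYX _]; apply/setP => z; rewrite !inE.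
    by have := subsetP sYX z; rewrite inE; case: (z \in X); case: (z \in Y) => // ->.
  by move=> Y Z /dif eY /dif eZ eYZ; rewrite -eY eYZ eZ.
rewrite -(card_in_imset inj); apply/subset_leq_card/subsetP => _ /imsetP[Y + ->].
by rewrite inE => /andP[].
Qed.

Lemma min_degree_le (k : nat) (P : 'I_k -> {set V}) H L X :
  legal_set P L X -> min_degree P H L <= #|nbhd H X|.
Proof.
move=> lX; rewrite /min_degree; have := mem_index_enum X.
elim: (index_enum _) => //= Y s IHs; rewrite big_cons inE => /orP[/eqP <-|/IHs le_s].
  by rewrite lX geq_minl.
by case: ifP => // _; rewrite geq_min le_s orbT.
Qed.

Lemma min_degree_attained (k : nat) (P : 'I_k -> {set V}) H L X0 :
  legal_set P L X0 ->
  exists2 X, legal_set P L X & min_degree P H L = #|nbhd H X|.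
Proof.
move=> lX0; case: (arg_minnP (fun X => #|nbhd H X|) lX0) => X lX minX.
exists X => //; apply/eqP; rewrite eqn_leq min_degree_le //=.
apply: (big_ind (fun m => #|nbhd H X| <= m)) => [|m p Xm Xp|Y lY].
- exact: card_nbhd_le.
- by rewrite leq_min Xm.
- exact: minX.
Qed.

End Degrees.

Section Embeddings.
Variables VG VH : finType.
Implicit Types (G : hypergraph VG) (H : hypergraph VH).

Definition is_embedding G H (phi : {ffun VG -> VH}) : bool :=
  injectiveb phi && [forall e in G, phi @: e \in H].

Definition embedding G H := {phi : {ffun VG -> VH} | is_embedding G H phi}.

End Embeddings.

Section Distributions.
Variable R : realType.

Record distribution (T : finType) := Distribution {
  mass :> T -> R;
  mass_ge0 : forall t, 0 <= mass t;
  mass_sum1 : \sum_t mass t = 1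
}.

Definition prob (T : finType) (mu : distribution T) (A : {set T}) : R :=
  \sum_(t in A) mu t.

Definition vertex_spread (VG VH : finType) (G : hypergraph VG)
    (H : hypergraph VH) (q : R) (mu : distribution (embedding G H)) : Prop :=
  0 <= q <= 1 /\
  forall (r : nat) (x : r.-tuple VG) (y : r.-tuple VH), uniq x -> uniq y ->
    prob mu [set phi : embedding G H |
              [forall i, val phi (tnth x i) == tnth y i]] <= q ^+ r.

End Distributions.

(* n disjoint edges on the kn vertices (i, j), the i-th one being {i} * [k]. *)
Definition perfect_matching (n k : nat) : hypergraph ('I_n * 'I_k)%type :=
  [set [set (i, j) | j : 'I_k] | i : 'I_n].

(* Main.v *)
Require Import Defs.
From mathcomp Require Import all_boot all_order all_algebra all_fingroup.
From mathcomp Require Import reals zify ring lra.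

(* Label each part by {0, ..., n-1} and let w be a tuple of k independent
   uniform permutations.  Its L-coordinates group the parts in L into n random
   L-tuples, the others give n random tuples over the complement of L; joining
   two tuples when their union is an edge of H yields a bipartite graph B_w on
   n + n vertices.  A switching argument gives exponential concentration of the
   degrees of B_w, so that with probability at least 1/2, for all K <= t <= n at
   once, the first t tuples of each kind induce a subgraph whose two relative
   minimum degrees sum to more than 1 + eps/2.

   For such w, a uniform perfect matching t of B_w is O(1/n)-spread.  Replacing
   three edges of a matching by three others shows that prescribing one more
   edge divides the number of matchings by at least a constant times the number
   of vertices left.  This settles the case of few prescribed edges; applied
   along the prefixes it also gives at least n! / C^n perfect matchings, which
   settles the case of linearly many, since at most (n-m)! permutations extend m
   prescribed values.

   The embedding sends (i, j) to the vertex of part j with label w_j(i) if j is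
   in L, and w_j(t(i)) otherwise. *)

Set Implicit Arguments.
Unset Strict Implicit.
Unset Printing Implicit Defensive.

Import Order.TTheory GRing.Theory Num.Theory.

(** * Permutations with prescribed values *)

(** Termwise, [r ^ r] is at most the falling factorial [(r + r) ^_ r], which is r! times a binomial
    coefficient bounded by [2 ^ (r + r)]. *)
Lemma expnn_le_fact r : r ^ r <= 4 ^ r * r`!.
Proof.
apply: (@leq_trans ((r + r) ^_ r)).
  rewrite ffact_prod -[X in _ ^ X]card_ord -prod_nat_const.
  by apply: leq_prod => i _; rewrite -addnBA // ?leq_addr // ltnW.
rewrite -bin_ffact leq_mul2r; apply/orP; right.
rewrite -[4]/(2 ^ 2) -expnM mul2n -addnn -[2]/(1 + 1) expnDn.
have lt_r : r < (r + r).+1 by lia.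
rewrite (bigD1 (Ordinal lt_r)) //= !exp1n !muln1; exact: leq_addr.
Qed.

(** Multiplying [(r - i) * n <= r * (n - i)] over [i < r] bounds r! n^r by [r ^ r * n ^_ r]; then
    [expnn_le_fact] lets r! cancel. *)
Lemma expn_fact_le n r : r <= n -> n ^ r * (n - r)`! <= 4 ^ r * n`!.
Proof.
move=> le_rn; rewrite -(ffact_fact le_rn) mulnA leq_mul2r; apply/orP; right.
rewrite -(leq_pmul2r (fact_gt0 r)).
apply: (@leq_trans (r ^ r * n ^_ r)); last first.
  by rewrite mulnAC leq_mul2r expnn_le_fact orbT.
have expE m : m ^ r = \prod_(i < r) m by rewrite prod_nat_const card_ord.
rewrite -ffactnn !ffact_prod !expE -!big_split /=.
by apply: leq_prod => i _; rewrite !mulnBr mulnC leq_sub2l // leq_mul2r le_rn orbT.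
Qed.

(** These permutations are exactly the [p * s] with [p] supported outside [I]. *)
Lemma card_perm_agree (T : finType) (I : {set T}) (s : {perm T}) :
  #|[set t : {perm T} | [forall i in I, t i == s i]]| = (#|T| - #|I|)`!.
Proof.
have -> : [set t : {perm T} | [forall i in I, t i == s i]]
          = [set (p * s)%g | p in perm_on (~: I)].
  apply/setP => t; rewrite !inE; apply/forall_inP/imsetP => [ag|[p pI ->] i iI].
    exists (t * s^-1)%g; last by rewrite mulgKV.
    apply/subsetP => i; rewrite !inE permM; apply: contraNN => iI.
    by rewrite (eqP (ag i iI)) permK.
  by rewrite permM (out_perm pI) // inE iI.
rewrite card_imset; last exact: mulIg.
by rewrite card_perm cardsCs setCK.
Qed.

Definition rot3 (T : finType) (x y z : T) : {perm T} := (tperm x y * tperm x z)%g.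

Lemma rot3E (T : finType) (x y z : T) : x != y -> x != z -> y != z ->
  [/\ rot3 x y z x = y, rot3 x y z y = z, rot3 x y z z = x
    & forall t, t != x -> t != y -> t != z -> rot3 x y z t = t].
Proof.
move=> xy xz yz; rewrite /rot3; split=> [||| t tx ty tz]; rewrite permM.
- by rewrite tpermL tpermD // eq_sym.
- by rewrite tpermR tpermL.
- by rewrite (tpermD xz yz) tpermR.
- by rewrite !tpermD // eq_sym.
Qed.

Lemma card_set_pair (S T : finType) (A : {set S * T}) :
  #|A| = \sum_x #|[set y | (x, y) \in A]|.
Proof.
rewrite -sum1_card big_mkcond (eq_bigr (fun p => if (p.1, p.2) \in A then 1 else 0)).
  rewrite -(pair_bigA _ (fun x y => if (x, y) \in A then 1 else 0)) /=.
  by apply: eq_bigr => x _; rewrite -big_mkcond -sum1_card; apply: eq_bigl => y; rewrite inE.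
by case.
Qed.

(** * Switchings in bipartite graphs *)

Section Switching.
Variables (T : finType) (B : rel T).
Implicit Types (s t M : {perm T}) (I J : {set T}).

(* Perfect matchings that agree with [s] on [I]; only the edges at the other
   vertices are required to be in the graph, so that [matchings s I] describes
   the perfect matchings of B minus the vertices of [I] and [s @: I]. *)
Definition matchings s I : {set {perm T}} :=
  [set t : {perm T} | [forall i, if i \in I then t i == s i else B i (t i)]].

Lemma matchingsP s I t :
  reflect ((forall i, i \in I -> t i = s i) /\ (forall i, i \notin I -> B i (t i)))
          (t \in matchings s I).
Proof.
rewrite inE; apply: (iffP forallP) => [tP|[tI tN] i].
  by split=> i iI; have := tP i; [rewrite iI => /eqP | rewrite (negbTE iI)].
by case: ifPn => [/tI ->|/tN].
Qed.

(* Bounding the number of missing neighbours, rather than the degrees, makes the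
   condition stable under deletion of vertices. *)
Definition few_missing I J a b :=
  (forall i, i \notin I -> #|[set j | (j \notin J) && ~~ B i j]| <= a) /\
  (forall j, j \notin J -> #|[set i | (i \notin I) && ~~ B i j]| <= b).

Lemma few_missingS I I' s a b : I \subset I' ->
  few_missing I (s @: I) a b -> few_missing I' (s @: I') a b.
Proof.
move=> sII' [mL mR]; have sJ := imsetS s sII'; split=> i iI.
  apply: leq_trans (mL i _); last by apply: contra iI; apply: subsetP.
  apply/subset_leq_card/subsetP => j; rewrite !inE => /andP[jI ->]; rewrite andbT.
  by apply: contra jI; apply: subsetP.
apply: leq_trans (mR i _); last by apply: contra iI; apply: subsetP.
apply/subset_leq_card/subsetP => j; rewrite !inE => /andP[jI ->]; rewrite andbT.
by apply: contra jI; apply: subsetP.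
Qed.

(** Pairs [(x, y)] for which rotating [M] along [u], [x], [y], that is, giving them the partners
    [M x], [M y], [M u], creates only edges of [B]. *)
Definition switches M I u : {set T * T} :=
  [set p | [&& p.1 \notin I, p.2 \notin I, p.1 != u, p.2 != u, p.1 != p.2,
               B u (M p.1), B p.1 (M p.2) & B p.2 (M u)]].

(** Greedy choice: [x] avoids [u] and the at most [a] vertices matched to missing neighbours of [u];
    then [y] avoids [u], [x], at most [a] vertices because of [x] and at most [b] because of
    [M u]. *)
Lemma card_switches M I a b u : u \notin I -> few_missing I (M @: I) a b ->
  (#|~: I| - (a + b + 2)) ^ 2 <= #|switches M I u|.
Proof.
move=> uI [mL mR].
have misL x : x \notin I -> #|[set i | (i \notin I) && ~~ B x (M i)]| <= a.
  move=> xI; apply: leq_trans (mL x xI).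
  rewrite -(card_imset _ (@perm_inj _ M)); apply/subset_leq_card/subsetP => _ /imsetP[i + ->].
  by rewrite !inE mem_imset //; exact: perm_inj.
have {}mR : #|[set i | (i \notin I) && ~~ B i (M u)]| <= b.
  by apply: mR; rewrite mem_imset //; exact: perm_inj.
pose X1 := [set x | [&& x \notin I, x != u & B u (M x)]].
have cX1 : #|~: I| - (a + b + 2) <= #|X1|.
  have /subset_leq_card : ~: I \subset
      X1 :|: ([set u] :|: [set i | (i \notin I) && ~~ B u (M i)]).
    apply/subsetP => x; rewrite !inE => ->.
    by case: (x == u) => //=; case: (B u (M x)).
  move/leq_trans/(_ (leq_card_setU _ _).1).
  have := (leq_card_setU [set u] [set i | (i \notin I) && ~~ B u (M i)]).1.
  rewrite cards1; have := misL _ uI; lia.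
rewrite card_set_pair.
apply: (@leq_trans (\sum_(x in X1) (#|~: I| - (a + b + 2)))).
  by rewrite sum_nat_const expnS expn1 leq_mul2r cX1 orbT.
rewrite [X in X <= _]big_mkcond /=; apply: leq_sum => x _; case: ifP => //.
rewrite inE => /and3P[xI xu Bux].
have /subset_leq_card : ~: I \subset [set y | (x, y) \in switches M I u] :|:
   ([set u; x] :|: ([set i | (i \notin I) && ~~ B x (M i)] :|:
     [set i | (i \notin I) && ~~ B i (M u)])).
  apply/subsetP => y; rewrite !inE /= => yI; rewrite yI xI xu Bux /= [x == y]eq_sym.
  by case: (y == u); case: (y == x) => //=; case: (B x _); case: (B y _).
move/leq_trans/(_ (leq_card_setU _ _).1).
have := (leq_card_setU [set u; x] ([set i | (i \notin I) && ~~ B x (M i)] :|: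
     [set i | (i \notin I) && ~~ B i (M u)])).1.
have := (leq_card_setU [set i | (i \notin I) && ~~ B x (M i)]
     [set i | (i \notin I) && ~~ B i (M u)]).1.
rewrite cards2; have := misL _ xI; clear mL misL; case: (u != x) => /=; lia.
Qed.

Lemma switchesP M I u p : u \notin I -> p \in switches M I u ->
  let M' := (rot3 u p.1 p.2 * M)%g in
  [/\ M' p.2 = M u, p.1 \notin I,
      forall i, i \notin [:: u; p.1; p.2] -> M' i = M i &
      forall i, i \in [:: u; p.1; p.2] -> (i \notin I) && B i (M' i)].
Proof.
case: p => x y uI; rewrite inE => /and5P[/= xI yI xu yu /and4P[xy Bux Bxy Byu]].
rewrite eq_sym in xu; rewrite eq_sym in yu.
move: (rot3 u x y) (rot3E xu yu xy) => R [Ru Rx Ry Ro].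
split=> // [|i|i]; rewrite ?permM ?Ry //.
  by rewrite !inE !negb_or => /and3P[iu ix iy]; rewrite Ro.
by rewrite !inE => /or3P[]/eqP ->; rewrite ?uI ?xI ?yI ?Ru ?Rx ?Ry.
Qed.

(* Rotating M along (u, x, y) drops the edge u -- M u.  Conversely y is read off
   the new matching as the partner of [s u], so x alone recovers M. *)
Lemma switching s I a b u : u \notin I -> few_missing I (s @: I) a b ->
  #|matchings s (u |: I)| * (#|~: I| - (a + b + 2)) ^ 2 <= #|matchings s I| * #|~: I|.
Proof.
move=> uI fm; pose e := (#|~: I| - (a + b + 2)) ^ 2.
pose Z := [set q : {perm T} * (T * T) |
            (q.1 \in matchings s (u |: I)) && (q.2 \in switches q.1 I u)].
have leZ : #|matchings s (u |: I)| * e <= #|Z|.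
  rewrite card_set_pair -sum_nat_const big_mkcond; apply: leq_sum => M _.
  case: ifP => // /[dup] MN /matchingsP[MI _].
  have -> : [set y | (M, y) \in Z] = switches M I u.
    by apply/setP => y; rewrite inE [_ \in Z]inE MN.
  apply: card_switches => //; suff <- : s @: I = M @: I by [].
  by apply: eq_in_imset => i iI; rewrite MI // !inE iI orbT.
have ZP q : q \in Z -> q.1 \in matchings s (u |: I) /\ q.2 \in switches q.1 I u.
  by rewrite [_ \in Z]inE => /andP.
apply: leq_trans leZ _.
pose f (q : {perm T} * (T * T)) := ((rot3 u q.2.1 q.2.2 * q.1)%g, q.2.1).
have injf : {in Z &, injective f}.
  move=> [M [x y]] [N [x' y']] /ZP[/matchingsP[MI _] swM] /ZP[/matchingsP[NI _] swN] [eqf eqx].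
  rewrite /= in MI swM NI swN.
  have [My _ _ _] := switchesP uI swM; have [Ny _ _ _] := switchesP uI swN.
  have eqy : y = y'.
    apply: (@perm_inj _ (rot3 u x y * M)%g); rewrite My eqf Ny.
    by rewrite MI ?NI // !inE eqxx.
  by move: eqf; rewrite eqx eqy => /mulgI ->.
rewrite -(card_in_imset injf) -cardsX; apply/subset_leq_card/subsetP.
move=> _ /imsetP[[M p] /ZP[/matchingsP[MI MN] sw] ->].
have [_ xI Mo Mi] := switchesP uI sw; rewrite !inE /=; rewrite xI andbT.
apply/forallP => i; case: ifPn => iI.
  rewrite Mo; first by rewrite MI // !inE iI orbT.
  by apply/negP => /Mi; rewrite iI.
have [/Mi /andP[] //|io] := boolP (i \in [:: u; p.1; p.2]).
rewrite Mo // MN // !inE negb_or iI andbT.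
by move: io; rewrite inE negb_or => /andP[].
Qed.

(* A permutation with the most real edges has no fake one: a switching at a fake
   edge would make all three edges involved real. *)
Lemma matchings_neq0 s I a b : few_missing I (s @: I) a b -> a + b + 2 < #|~: I| ->
  0 < #|matchings s I|.
Proof.
move=> fm lt_ab.
pose ag M := [forall i in I, M i == s i].
pose real M := #|[set i | (i \notin I) && B i (M i)]|.
have ags : ag s by apply/forall_inP.
case: (arg_maxnP real ags) => M agM maxM.
have eqI : M @: I = s @: I by apply: eq_in_imset => i iI; rewrite (eqP (forall_inP agM i iI)).
apply/card_gt0P; exists M; apply/matchingsP; split=> [i iI|u uI].
  exact/eqP/(forall_inP agM).
apply/negPn/negP => nBu.
have /card_gt0P[p sw] : 0 < #|switches M I u|.
  by apply: leq_trans (@card_switches M I a b u uI _); rewrite ?eqI // expn_gt0; lia.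
have [_ _ Mo Mi] := switchesP uI sw.
have /maxM : ag (rot3 u p.1 p.2 * M)%g.
  apply/forall_inP => i iI; rewrite Mo ?(forall_inP agM) //.
  by apply/negP => /Mi; rewrite iI.
apply/negP; rewrite -ltnNge; apply: proper_card; apply/properP; split.
  apply/subsetP => i; rewrite !inE => /andP[iI Bi]; rewrite iI /=.
  by have [/Mi /andP[]|io] := boolP (i \in [:: u; p.1; p.2]); last rewrite Mo.
exists u; rewrite !inE ?(negbTE nBu) ?andbF //.
by apply: Mi; rewrite !inE eqxx.
Qed.

End Switching.

(** With t the size of [~: I], the hypothesis on [g] says t <= g (t - (a + b + 2)). So there are at
    least (t / g)^2 switchings, and one factor t cancels in [switching]. *)
Lemma switching_ratio (T : finType) (B : rel T) (s : {perm T}) (I : {set T}) a b g u :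
    u \notin I -> few_missing B I (s @: I) a b -> g * (a + b + 2) + #|~: I| <= g * #|~: I| ->
  #|~: I| * #|matchings B s (u |: I)| <= g ^ 2 * #|matchings B s I|.
Proof.
move=> uI fm; have T0 : 0 < #|~: I| by apply/card_gt0P; exists u; rewrite inE.
have := switching uI fm; move: #|~: I| (#|matchings _ _ _|) (#|matchings _ _ _|) T0.
move=> t N N' t0 le_sw le_g.
have {}le_g : t <= g * (t - (a + b + 2)) by rewrite mulnBr; lia.
rewrite -(leq_pmul2r t0); apply: (@leq_trans (N' * t ^ 2)).
  by rewrite -mulnn mulnA [t * N']mulnC.
apply: (@leq_trans (N' * (g * (t - (a + b + 2))) ^ 2)).
  by rewrite leq_mul2l leq_exp2r // le_g orbT.
by rewrite expnMn mulnCA -mulnA leq_mul2l le_sw orbT.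
Qed.

(** * Counting perfect matchings along prefixes, and their spread *)

Section PrefixSpread.
Variables (n g K : nat) (B : rel 'I_n).
Hypothesis (g_gt0 : 0 < g) (K_gt0 : 0 < K).

Definition tail t : {set 'I_n} := [set i : 'I_n | t <= i].

Lemma card_tailC t : t <= n -> #|~: tail t| = t.
Proof.
move=> tn; have -> : ~: tail t = [set widen_ord tn i | i in 'I_t].
  apply/setP => i; rewrite !inE -ltnNge; apply/idP/imsetP => [it|[j _ ->]].
    by exists (Ordinal it) => //; apply: val_inj.
  exact: (ltn_ord j).
by rewrite card_imset ?card_ord // => i j /(congr1 val) /= ij; apply: val_inj.
Qed.

(** Deleting [tail t] on both sides leaves the first [t] vertices of each; the inequality makes the
    guaranteed degrees [t - a] and [t - b] sum to at least (1 + 1/g) t + 2. *)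
Definition prefix_good t := exists a b,
  few_missing B (tail t) (tail t) a b /\ g * (a + b + 2) + t <= g * t.

Hypothesis good : forall t, K <= t <= n -> prefix_good t.
Hypothesis le_Kn : K <= n.

Local Notation PM := (matchings B 1%g set0).

(** Induction from [K], where the existence of one matching suffices. Restoring the vertex of index
    t on both sides multiplies the number of matchings by at least (t + 1) / g^2. *)
Lemma tail_matchings_ge t : K <= t <= n ->
  t`! <= K`! * (g ^ 2) ^ t * #|matchings B 1%g (tail t)|.
Proof.
have id1 (I : {set 'I_n}) : (1%g : {perm 'I_n}) @: I = I.
  by rewrite (eq_imset (g := id)) ?imset_id // => i; rewrite perm1.
case/andP => Kt; rewrite -(subnKC Kt); elim: (t - K) => [|d IH] tn.
  rewrite addn0 in tn *; have [a [b [fm le_g]]] : prefix_good K by apply: good; rewrite leqnn.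
  rewrite -mulnA leq_pmulr // muln_gt0 !expn_gt0 g_gt0 /=.
  apply: (@matchings_neq0 _ B 1%g (tail K) a b); first by rewrite id1.
  rewrite card_tailC // ltnNge; apply/negP => leK.
  by move: le_g; have := leq_mul (leqnn g) leK; lia.
have [a [b [fm le_g]]] : prefix_good (K + d.+1) by apply: good; rewrite leq_addr.
rewrite addnS in tn fm le_g *; set t' := K + d in IH tn fm le_g *.
(* Relative to the identity, prescribing the pair of vertices of index [t'] just deletes them; the
   pair need not be an edge. *)
have := @switching_ratio _ B 1%g (tail t'.+1) a b g (Ordinal tn).
rewrite card_tailC // id1 !inE /= ltnn => /(_ isT fm le_g).
have -> : Ordinal tn |: tail t'.+1 = tail t'.
  by apply/setP => i; rewrite !inE [t' <= i]leq_eqVlt [t' == _]eq_sym.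
move=> le_sw; rewrite factS; apply: (leq_trans (leq_mul (leqnn t'.+1) (IH (ltnW tn)))).
rewrite mulnCA [_ ^ t'.+1]expnSr -!mulnA leq_mul2l; apply/orP; right.
by rewrite leq_mul2l [g * _]mulnA mulnn le_sw orbT.
Qed.

Lemma PM_ge : n`! <= K`! * (g ^ 2) ^ n * #|PM|.
Proof.
have := @tail_matchings_ge n; rewrite le_Kn leqnn => /(_ isT).
suff -> : tail n = set0 by [].
by apply/setP => i; rewrite !inE leqNgt ltn_ord.
Qed.

Lemma PM_gt0 : 0 < #|PM|.
Proof.
by have := leq_trans (fact_gt0 n) PM_ge; rewrite muln_gt0 => /andP[].
Qed.

(** The edges are prescribed one at a time. While at most n / (2g) vertices are removed, the
    condition at [n] survives with [2 * g] for [g], and at least n/2 vertices remain; each step thus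
    costs a factor 2 (2g)^2 / n. *)
Lemma few_extensions (s : {perm 'I_n}) (I : {set 'I_n}) : 2 * g * #|I| <= n ->
  #|matchings B s I| * n ^ #|I| <= (8 * g ^ 2) ^ #|I| * #|PM|.
Proof.
have [m] := ubnP #|I|; elim: m I => // m IH I; rewrite ltnS => leIm lt_g.
have [->|[u uI]] := set_0Vmem I.
  rewrite cards0 !muln1 mul1n; apply/subset_leq_card/subsetP => t.
  by move=> /matchingsP[_ tP]; apply/matchingsP; split=> [i|]; rewrite ?inE.
have cI : #|I| = #|I :\ u|.+1 by rewrite (cardsD1 u) uI.
have uJ : u \notin I :\ u by rewrite !inE eqxx.
have [a [b [fm le_g]]] : prefix_good n by apply: good; rewrite le_Kn leqnn.
have t0 : tail n = set0 by apply/setP => i; rewrite !inE leqNgt ltn_ord.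
have {}fm : few_missing B (I :\ u) (s @: (I :\ u)) a b.
  by apply: (few_missingS (sub0set _)); rewrite imset0 -t0.
have := @switching_ratio _ B s (I :\ u) a b (2 * g) u uJ fm.
have cJ : #|~: (I :\ u)| + #|I :\ u| = n.
  by rewrite addnC cardsC card_ord.
rewrite setD1K //; move: IH => /(_ (I :\ u)).
rewrite cI; move: #|I :\ u| (#|~: (I :\ u)|) cI cJ => j c cI cJ IH.
have gj : j + j <= 2 * g * j by rewrite addnn -mul2n leq_mul2r leq_pmulr ?orbT.
have le1 : 2 * g * (a + b + 2) + c <= 2 * g * c.
  have -> : c = n - j by lia.
  have : 2 * (g * (a + b + 2) + n) <= 2 * (g * n) by rewrite leq_mul2l.
  rewrite mulnBr; move: lt_g; rewrite cI mulnS -!mulnA mulnDr; lia.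
move=> /(_ le1) le_sw; have {}IH : #|matchings B s (I :\ u)| * n ^ j <= (8 * g ^ 2) ^ j * #|PM|.
  by apply: IH; [lia | move: lt_g; rewrite cI mulnS; lia].
have n2c : n <= 2 * c by rewrite cI mulnS in lt_g; lia.
apply: (@leq_trans (8 * g ^ 2 * (#|matchings B s (I :\ u)| * n ^ j))); last first.
  by rewrite [_ ^ j.+1]expnS -[X in _ <= X]mulnA leq_mul2l IH orbT.
rewrite [n ^ _]expnS mulnA [X in _ <= X]mulnA leq_mul2r; apply/orP; right.
rewrite mulnC; apply: leq_trans (leq_mul n2c (leqnn _)) _; rewrite -mulnA.
apply: leq_trans (leq_mul (leqnn 2) le_sw) _.
by rewrite expnMn !mulnA.
Qed.

(** The factor [8 * g ^ 2] is the price per edge when few are prescribed; the other one spreads the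
    loss of [PM_ge] over [I] when [n < 2 * g * #|I|]. *)
Definition spread_const := 8 * g ^ 2 * (4 * K`! * (g ^ 2) ^ (2 * g)).

Lemma PM_spread (s : {perm 'I_n}) (I : {set 'I_n}) :
  #|[set t in PM | [forall i in I, t i == s i]]| * n ^ #|I| <= spread_const ^ #|I| * #|PM|.
Proof.
have gt1 : 0 < 4 * K`! * (g ^ 2) ^ (2 * g) by rewrite !muln_gt0 fact_gt0 !expn_gt0 g_gt0.
have gt2 : 0 < 8 * g ^ 2 by rewrite muln_gt0 expn_gt0 g_gt0.
have [le_g|lt_g] := leqP (2 * g * #|I|) n.
  apply: (@leq_trans (#|matchings B s I| * n ^ #|I|)).
    rewrite leq_mul2r; apply/orP; right; apply/subset_leq_card/subsetP => t.
    rewrite [t \in _]inE => /andP[/matchingsP[_ tP] /forall_inP ag].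
    by apply/matchingsP; split=> [i /ag /eqP|i _] //; apply: tP; rewrite inE.
  apply: (leq_trans (few_extensions s le_g)); rewrite leq_mul2r; apply/orP; right.
  by rewrite /spread_const [X in _ <= X]expnMn leq_pmulr // expn_gt0 gt1.
(* Many prescribed edges: all permutations extending them are counted, and their number is compared
   with the lower bound [PM_ge]. *)
have leIn : #|I| <= n by rewrite -[n in _ <= n]card_ord max_card.
apply: (@leq_trans ((n - #|I|)`! * n ^ #|I|)).
  rewrite leq_mul2r; apply/orP; right; rewrite -[n in n - _]card_ord -(card_perm_agree I s).
  by apply/subset_leq_card/subsetP => t; rewrite [t \in _]inE => /andP[_]; rewrite inE.
rewrite mulnC; apply: leq_trans (expn_fact_le leIn) _.
apply: leq_trans (leq_mul (leqnn _) PM_ge) _; rewrite mulnA leq_mul2r; apply/orP; right.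
rewrite /spread_const [X in _ <= X]expnMn;
apply: leq_trans (leq_pmull _ _); last by rewrite expn_gt0 gt2.
rewrite !expnMn -!mulnA leq_mul2l; apply/orP; right; apply: leq_mul.
  rewrite -[X in X <= _]expn1 leq_pexp2l ?fact_gt0 //.
  by rewrite lt0n; apply/negP => /eqP I0; rewrite I0 muln0 in lt_g.
by apply: leq_mul; rewrite -expnM leq_pexp2l // ltnW.
Qed.

End PrefixSpread.

(** * Concentration of the degrees *)

Section Concentration.
Variables (k n : nat) (h : pred {ffun 'I_k -> 'I_n}).
Local Notation W := {ffun 'I_k -> {perm 'I_n}}.
Implicit Types (L : {set 'I_k}) (w : W) (i s : 'I_n) (S : {set 'I_n}).

(** The join of the [i]-th tuple over [L] and the [s]-th tuple over its complement;
    [h (mix L w i s)] is adjacency of [i] and [s] in B_w. *)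
Definition mix L w i s : {ffun 'I_k -> 'I_n} := [ffun j => w j (if j \in L then i else s)].

Definition non_extensions L (x : {ffun 'I_k -> 'I_n}) :=
  [set f : {ffun 'I_k -> 'I_n} | [forall j in L, f j == x j] && ~~ h f].

Definition bad L i S : {set W} := [set w : W | [forall s in S, ~~ h (mix L w i s)]].

Lemma badP L i S w : reflect {in S, forall s, ~~ h (mix L w i s)} (w \in bad L i S).
Proof. by rewrite inE; apply: forall_inP. Qed.

(* Swapping the values of [w j] at [s] and [y j], for j outside L, keeps the tuples
   indexed by S; going back, y is determined by the tuple that [w] has at [s]. *)
Lemma bad_switching L i S s D : s \notin S -> (forall x, #|non_extensions L x| <= D) ->
  #|bad L i (s |: S)| * (n - #|S|) ^ #|~: L| <= #|bad L i S| * D.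
Proof.
move=> sS leD.
(* The default value [s] on [L] makes [tperm s (y j)] trivial there, so [act y] leaves these
   coordinates alone. *)
pose Y : {set {ffun 'I_k -> 'I_n}} := [set y in pffun_on s (mem (~: L)) (mem (~: S))].
have cY : #|Y| = (n - #|S|) ^ #|~: L|.
  rewrite cardsE card_pffun_on; congr (_ ^ _).
  by rewrite -[LHS]/(#|~: S|) cardsCs setCK card_ord.
have YL y j : y \in Y -> j \in L -> y j = s.
  rewrite inE => /pffun_onP[/supportP/(_ j) yL _] jL.
  by apply: yL; rewrite /= inE negbK.
have YS y j : y \in Y -> y j \notin S.
  move=> yY; have [jL|jL] := boolP (j \in L); first by rewrite (YL y).
  move: yY; rewrite inE => /pffun_onP[yL /(_ (y j))].
  by rewrite -in_setC; apply; apply/imageP; exists j => //; rewrite -topredE /= -in_setC in jL *.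
pose act (y : {ffun 'I_k -> 'I_n}) w : W := [ffun j => (tperm s (y j) * w j)%g].
have actK y : involutive (act y).
  by move=> w; apply/ffunP => j; rewrite !ffunE mulgA tperm2 mul1g.
have actS y w s' : y \in Y -> s' \in S -> mix L (act y w) i s' = mix L w i s'.
  move=> yY s'S; apply/ffunP => j; rewrite !ffunE permM; case: ifPn => jL.
    by rewrite (YL y) // tperm1 perm1.
  rewrite tpermD //; first by apply: contraNneq sS => ->.
  by apply: contraNneq (YS y j yY) => ->.
have actE y w : y \in Y ->
    mix L (act y w) i s = [ffun j => w j (if j \in L then i else y j)].
  move=> yY; apply/ffunP => j; rewrite !ffunE permM; case: ifPn => jL.
    by rewrite (YL y) // tperm1 perm1.
  by rewrite tpermL.
rewrite -cY -cardsX.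
pose Z := [set q : W * {ffun 'I_k -> 'I_n} |
            [&& q.1 \in bad L i S, q.2 \in Y & ~~ h (mix L (act q.2 q.1) i s)]].
apply: (@leq_trans #|Z|).
  pose f (q : W * {ffun 'I_k -> 'I_n}) := (act q.2 q.1, q.2).
  have injf : injective f.
    by move=> [w y] [w' y'] [/= + eqy]; rewrite -eqy => /(can_inj (actK y)) ->.
  rewrite -(card_imset (setX _ _) injf).
  apply/subset_leq_card/subsetP => _ /imsetP[[w y] + ->].
  rewrite in_setX /= => /andP[/badP wb yY]; rewrite [_ \in Z]inE /= yY actK wb ?setU11 ?andbT //.
  by apply/badP => s' s'S; rewrite actS // wb // !inE s'S orbT.
rewrite card_set_pair -sum_nat_const [X in _ <= X]big_mkcond /=; apply: leq_sum => w _.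
case: ifPn => wb; last first.
  by rewrite eq_card0 // => y; rewrite inE [_ \in Z]inE /= (negbTE wb).
apply: leq_trans (leD [ffun j => w j i]).
have injm : {in [set y | (w, y) \in Z] &, injective (fun y => mix L (act y w) i s)}.
  move=> y y'; rewrite inE [_ \in Z]inE /= => /and3P[_ yY _].
  rewrite inE [_ \in Z]inE /= => /and3P[_ y'Y _]; rewrite !actE // => /ffunP eqy.
  apply/ffunP => j; have := eqy j; rewrite !ffunE; case: ifPn => [jL _|_ /perm_inj //].
  by rewrite !(YL _ j).
rewrite -(card_in_imset injm); apply/subset_leq_card/subsetP => _ /imsetP[y + ->].
rewrite inE [_ \in Z]inE /= => /and3P[_ yY hy]; rewrite inE hy andbT actE //.
by apply/forall_inP => j jL; rewrite !ffunE jL.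
Qed.

(** Iterating [bad_switching], each element of [S] contributes a factor at most D / (n - m)^d to the
    probability, with d the size of [~: L]. *)
Lemma bad_le L i S D m : (forall x, #|non_extensions L x| <= D) -> #|S| <= m ->
  #|bad L i S| * ((n - m) ^ #|~: L|) ^ #|S| <= D ^ #|S| * n`! ^ k.
Proof.
move=> leD; have [c] := ubnP #|S|; elim: c S => // c IH S; rewrite ltnS => leSc leSm.
have [->|[s sS]] := set_0Vmem S.
  rewrite cards0 muln1 mul1n; apply: leq_trans (max_card _) _.
  by rewrite card_ffun card_ord card_Sn.
have cS : #|S| = #|S :\ s|.+1 by rewrite (cardsD1 s) sS.
have sJ : s \notin S :\ s by rewrite !inE eqxx.
have := bad_switching i sJ leD; rewrite setD1K // => sw.
have {}IH := IH (S :\ s); rewrite cS !expnS.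
apply: (@leq_trans (#|bad L i S| * (n - #|S :\ s|) ^ #|~: L| * ((n - m) ^ #|~: L|) ^ #|S :\ s|)).
  rewrite mulnA leq_mul2r leq_mul2l; apply/orP; right; apply/orP; right.
  have le_m : n - m <= n - #|S :\ s| by rewrite cS in leSm; lia.
  by case: #|~: L| => // e; rewrite leq_exp2r.
apply: (leq_trans (leq_mul sw (leqnn _))).
rewrite mulnAC [D * _]mulnC -!mulnA [D * _]mulnC !mulnA leq_mul2r IH ?orbT //; lia.
Qed.

(* Chernoff bound by the m-th factorial moment of the number of missing
   neighbours: any [theta] of them contain ['C(theta, m)] bad sets of size [m]. *)
Lemma many_bad_le L i D m theta (T : {set 'I_n}) :
    (forall x, #|non_extensions L x| <= D) ->
  #|[set w : W | theta <= #|[set s in T | ~~ h (mix L w i s)]|]|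
     * ((theta - m) * (n - m) ^ #|~: L|) ^ m
  <= (#|T| * D) ^ m * n`! ^ k.
Proof.
move=> leD; set E := [set w : W | _].
have [lt_th|le_m] := ltnP theta m.
  have -> : theta - m = 0 by lia.
  by rewrite mul0n exp0n ?muln0 //; lia.
(* Double counting of the pairs of [w] in [E] and an [m]-subset of [T] on which [w] is bad. *)
have count : #|E| * 'C(theta, m) * ((n - m) ^ #|~: L|) ^ m <= 'C(#|T|, m) * (D ^ m * n`! ^ k).
  pose Q := [set S : {set 'I_n} | (S \subset T) && (#|S| == m)].
  have -> : 'C(#|T|, m) = #|Q| by rewrite cards_draws.
  apply: (@leq_trans (\sum_(S in Q) #|bad L i S| * ((n - m) ^ #|~: L|) ^ m)); last first.
    rewrite -sum_nat_const; apply: leq_sum => S; rewrite inE => /andP[_ /eqP cS].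
    by have := @bad_le L i S D m leD; rewrite cS; apply.
  rewrite -big_distrl leq_mul2r; apply/orP; right.
  rewrite -sum_nat_const; under [X in _ <= X]eq_bigr do rewrite -sum1_card big_mkcond.
  rewrite exchange_big [X in X <= _]big_mkcond /=; apply: leq_sum => w _.
  case: ifP => //; rewrite inE => th_le.
  rewrite -big_mkcondr sum1_card.
  apply: leq_trans (leq_bin2l m th_le) _; rewrite -cards_draws.
  apply/subset_leq_card/subsetP => S; rewrite inE => /andP[/subsetP ST cS].
  rewrite unfold_in inE cS andbT; apply/andP; split.
    by apply/subsetP => s /ST; rewrite inE => /andP[].
  by apply/badP => s /ST; rewrite inE => /andP[].
(* Termwise comparison: [#|T| - j <= #|T|] and [theta - m <= theta - j] for [j < m]. *)
have cbin : 'C(#|T|, m) * (theta - m) ^ m <= #|T| ^ m * 'C(theta, m).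
  rewrite -(leq_pmul2r (fact_gt0 m)) mulnAC bin_ffact -mulnA bin_ffact.
  have expE c : c ^ m = \prod_(j < m) c by rewrite prod_nat_const card_ord.
  rewrite !ffact_prod !expE; apply: leq_mul; apply: leq_prod => j _; first exact: leq_subr.
  by apply: leq_sub2l; apply: ltnW.
have C0 : 0 < 'C(theta, m) by rewrite bin_gt0.
rewrite -(leq_pmul2r C0) !expnMn.
have {}count := leq_mul count (leqnn ((theta - m) ^ m)).
apply: leq_trans (leq_trans _ count) _; first by rewrite eq_leq //; lia.
by apply: leq_trans (leq_trans _ (leq_mul cbin (leqnn (D ^ m * n`! ^ k)))) _; rewrite eq_leq //; lia.
Qed.

End Concentration.

Lemma leq_card_bigcup (I T : finType) (P : pred I) (A : I -> {set T}) :
  #|\bigcup_(i | P i) A i| <= \sum_(i | P i) #|A i|.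
Proof.
elim/big_rec2: _ => [|i m B _ le_m]; first by rewrite cards0.
by apply: leq_trans (leq_card_setU _ _).1 _; rewrite leq_add2l.
Qed.

(** * Tail estimates and the union bound over prefixes *)

Section Tails.
Local Open Scope ring_scope.
Variable R : realType.
Implicit Types (x p : R).

(** Induction through (1 - x)(1 + (s + 1) x) <= 1 + s x; the point is the decay (1 - x)^s <= 1 / (s
    x). *)
Lemma expr_bernoulli_le1 x s : 0 <= x <= 1 -> (1 - x) ^+ s * (1 + s%:R * x) <= 1.
Proof.
move=> /andP[x0 x1]; elim: s => [|s IH]; first by rewrite expr0 mul0r addr0 mulr1.
apply: le_trans IH; rewrite exprSr -mulrA.
apply: ler_wpM2l; first by apply: exprn_ge0; lra.
rewrite -natr1; have : 0 <= s%:R :> R by [].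
nra.
Qed.

(* The right-hand side telescopes in the union bound over prefixes.  With an
   exponent [4 * s], the fourth power of Bernoulli's inequality beats [t ^ 3]. *)
Lemma geometric_tail x N : 0 < x <= 1 -> (0 < N)%N ->
  exists2 K, (1 < K)%N & forall t, (K <= t)%N ->
  2 * t%:R * (1 - x) ^+ (4 * (t %/ (4 * N))) <= t%:R^-1 - t.+1%:R^-1.
Proof.
move=> /andP[x0 x1] N0.
(* Chosen so that [c <= s] and [t <= 8 * N * s] together give 4 t^3 <= (s x)^4. *)
pose c := 4 * (8 * N%:R) ^+ 3 / x ^+ 4.
have c0 : 0 <= c by rewrite /c divr_ge0 ?mulr_ge0 ?exprn_ge0 // ltW.
exists (4 * N * (Num.truncn c).+1)%N; first by lia.
move=> t le_t; set s := (t %/ (4 * N))%N.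
have N4 : (0 < 4 * N)%N by rewrite muln_gt0.
have sc : ((Num.truncn c).+1 <= s)%N by rewrite leq_divRL // mulnC.
have cs : c <= s%:R.
  by apply: le_trans (ltW (truncnS_gt c)) _; rewrite ler_nat.
have s0 : (0 < s)%N by apply: leq_trans sc.
have ts : (t <= 8 * N * s)%N.
  have := ltn_ceil t N4; rewrite -/s; nia.
have t0 : (0 < t)%N by lia.
pose q := (1 - x) ^+ s.
have q0 : 0 <= q by apply: exprn_ge0; lra.
have qs : q * (s%:R * x) <= 1.
  have := @expr_bernoulli_le1 x s; rewrite (ltW x0) x1 -/q => /(_ isT).
  by apply: le_trans; rewrite mulrDr lerDr mulr1.
have q4 : q ^+ 4 * (s%:R * x) ^+ 4 <= 1.
  by rewrite -exprMn -[leRHS](expr1n _ 4) lerXn2r ?nnegrE // mulr_ge0 // mulr_ge0 // ltW.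
have sR : 0 < s%:R :> R by rewrite ltr0n.
have tR : 0 < t%:R :> R by rewrite ltr0n.
have t3 : t%:R ^+ 3 <= (8 * N%:R * s%:R) ^+ 3 :> R.
  by rewrite lerXn2r ?nnegrE ?mulr_ge0 // -!natrM ler_nat.
have key : 4 * t%:R ^+ 3 * q ^+ 4 <= 1.
  apply: le_trans q4; rewrite [leRHS]mulrC; apply: ler_wpM2r; first exact: exprn_ge0.
  have t4 : 4 * t%:R ^+ 3 <= 4 * (8 * N%:R) ^+ 3 * s%:R ^+ 3 :> R.
    by rewrite -mulrA -exprMn ler_wpM2l.
  apply: (le_trans t4).
  have -> : (s%:R * x) ^+ 4 = s%:R ^+ 3 * (s%:R * x ^+ 4) by ring.
  rewrite mulrC; apply: ler_wpM2l; first by rewrite exprn_ge0.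
  by move: cs; rewrite /c ler_pdivrMr // exprn_gt0.
have -> : t%:R^-1 - t.+1%:R^-1 = (t%:R * t.+1%:R)^-1 :> R.
  by rewrite -natr1; field; rewrite natr1 !pnatr_eq0 /= -lt0n.
rewrite -[leRHS]div1r ler_pdivlMr ?mulr_gt0 ?ltr0n //.
apply: le_trans key; rewrite mulnC exprM -/q.
have -> : 2 * t%:R * q ^+ 4 * (t%:R * t.+1%:R) = (2 * t%:R ^+ 2 * t.+1%:R) * q ^+ 4 by ring.
apply: ler_wpM2r; first exact: exprn_ge0.
have t1 : 1 <= t%:R :> R by rewrite ler1n.
rewrite -natr1; nra.
Qed.

End Tails.

Lemma mixC (k n : nat) (L : {set 'I_k}) (w : {ffun 'I_k -> {perm 'I_n}}) i s :
  mix (~: L) w s i = mix L w i s.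
Proof. by apply/ffunP => j; rewrite !ffunE inE; case: (j \in L). Qed.

Section GoodWeights.
Local Open Scope ring_scope.
Variables (R : realType) (k : nat).

Lemma bernoulli (x : R) s : 0 <= x <= 1 -> 1 - s%:R * x <= (1 - x) ^+ s.
Proof.
move=> /andP[x0 x1]; elim: s => [|s IH]; first by rewrite expr0 mul0r subr0.
rewrite exprSr; apply: (@le_trans _ _ ((1 - s%:R * x) * (1 - x))).
  rewrite -natr1; have : 0 <= s%:R :> R by [].
  nra.
by apply: ler_wpM2r => //; lra.
Qed.

(** At most t / N, so that subtracting it from [n] and from the threshold costs little; a multiple
    of 4 to suit [geometric_tail]. *)
Definition moment_order N t := (4 * (t %/ (4 * N)))%N.

(** For [p + eta >= 0] the threshold is the least integer exceeding [(p + eta) * t]. *)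
Definition overloaded n (h : pred {ffun 'I_k -> 'I_n}) L (p eta : R) t i :
    {set {ffun 'I_k -> {perm 'I_n}}} :=
  [set w | ((Num.truncn ((p + eta) * t%:R)).+1 <=
            #|[set s in ~: tail n t | ~~ h (mix L w i s)]|)%N].

(** This is [many_bad_le] with [m = moment_order N t]. As [N] is large, the losses due to [m] use up
    only part of the slack [eta], and the ratio raised to the power [m] stays below
    [1 - eta / 8]. *)
Lemma card_overloaded n (h : pred {ffun 'I_k -> 'I_n}) (L : {set 'I_k}) D (eta : R) N t i :
    0 < eta <= 1 -> (0 < t <= n)%N -> (0 < N)%N -> 8 * k.+1%:R <= eta * N%:R ->
    (forall x, #|non_extensions h L x| <= D)%N -> D%:R / n%:R ^+ #|~: L| <= 1 :> R ->
  #|overloaded h L (D%:R / n%:R ^+ #|~: L|) eta t i|%:R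
    <= (1 - eta / 8) ^+ moment_order N t * (n`!)%:R ^+ k.
Proof.
move=> /andP[e0 e1] /andP[t0 tn] N0 kN leD; set d := #|~: L|; set p := _ / _ => p1.
have n0 : (0 < n)%N by apply: leq_trans tn.
have nR : 0 < n%:R :> R by rewrite ltr0n.
have tR : 0 < t%:R :> R by rewrite ltr0n.
have NR : 0 < N%:R :> R by rewrite ltr0n.
have p0 : 0 <= p by rewrite /p divr_ge0 ?exprn_ge0.
set m := moment_order N t; set th := (Num.truncn ((p + eta) * t%:R)).+1.
have := @many_bad_le k n h L i D m th (~: tail n t) leD.
rewrite card_tailC // -/d => le_nat.
have th_gt : (p + eta) * t%:R < th%:R by apply: truncnS_gt.
have dk : (d <= k)%N by rewrite /d -[k in (_ <= k)%N]card_ord max_card.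
pose y : R := N%:R^-1.
have y0 : 0 < y by rewrite invr_gt0.
have ky : k.+1%:R * y <= eta / 8.
  by rewrite /y ler_pdivrMr //; lra.
have kR : 0 <= k%:R :> R by [].
have ye : y <= eta / 8.
  by apply: le_trans ky; rewrite -natr1; nra.
have mN : (m * N <= t)%N.
  by rewrite /m /moment_order mulnAC mulnC leq_divM.
have my : m%:R <= y * t%:R.
  by rewrite /y mulrC ler_pdivlMr // -natrM ler_nat.
have mt : (m <= t)%N by apply: leq_trans mN; rewrite leq_pmulr.
have thm : (p + eta - y) * t%:R <= (th - m)%:R.
  apply: (@le_trans _ _ (th%:R - m%:R)); first by nra.
  by rewrite lerBlDr -natrD ler_nat addnC -leq_subLR.
have nm : (1 - y) * n%:R <= (n - m)%:R.
  have le1 : n%:R <= (n - m)%:R + m%:R :> R by rewrite -natrD ler_nat addnC -leq_subLR.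
  have tnR : t%:R <= n%:R :> R by rewrite ler_nat.
  nra.
have y1 : 0 <= y <= 1 by rewrite ltW //; lra.
have nmd : n%:R ^+ d * (1 - k%:R * y) <= (n - m)%:R ^+ d.
  apply: (@le_trans _ _ ((n%:R * (1 - y)) ^+ d)).
    rewrite exprMn ler_wpM2l ?exprn_ge0 //.
    apply: le_trans (bernoulli d y1); rewrite lerB // ler_wpM2r ?(ltW y0) // ler_nat //.
  by rewrite lerXn2r ?nnegrE // 1?mulrC // mulr_ge0 //; lra.
set q := 1 - eta / 8; have q0 : 0 < q by rewrite /q; lra.
have nd : 0 < n%:R ^+ d :> R by rewrite exprn_gt0.
have Dp : D%:R = p * n%:R ^+ d by rewrite /p divfK // gt_eqF.
have kyk : 0 <= k%:R * y <= eta / 8.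
  by rewrite mulr_ge0 ?(ltW y0) //=; apply: le_trans ky; rewrite -natr1; nra.
set X : R := (th - m)%:R * (n - m)%:R ^+ d.
have leX : (p + eta - y) * t%:R * (n%:R ^+ d * (1 - k%:R * y)) <= X.
  by apply: ler_pM => //; apply: mulr_ge0; rewrite ?(ltW tR) ?(ltW nd) //; lra.
(* Since [y] and [k%:R * y] are at most [eta / 8], it suffices that p <= (1 - eta/4)(p + 7 eta/8),
   which follows from [p <= 1]. *)
have pq : p <= q * ((p + eta - y) * (1 - k%:R * y)).
  move: kyk; move: (k%:R * y) => z /andP[z0 ze].
  have le1 : 1 - eta / 4 <= q * (1 - z) by rewrite /q; nra.
  have le2 : p <= (1 - eta / 4) * (p + eta - y) by nra.
  apply: (le_trans le2); rewrite mulrCA mulrC; apply: ler_wpM2l => //; lra.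
have tDX : t%:R * D%:R <= q * X.
  rewrite Dp; apply: (@le_trans _ _ (q * ((p + eta - y) * (1 - k%:R * y)) * (t%:R * n%:R ^+ d))).
    by rewrite mulrCA; apply: ler_wpM2r => //; rewrite mulr_ge0 // ltW.
  apply: (@le_trans _ _ (q * ((p + eta - y) * t%:R * (n%:R ^+ d * (1 - k%:R * y))))).
    by rewrite le_eqVlt; apply/orP; left; apply/eqP; ring.
  by apply: ler_wpM2l => //; apply: ltW.
have X0 : 0 < X.
  apply: lt_le_trans leX; apply: mulr_gt0; apply: mulr_gt0 => //; lra.
have leR : #|overloaded h L p eta t i|%:R * X ^+ m <= (t%:R * D%:R) ^+ m * (n`!)%:R ^+ k :> R.
  by move: le_nat; rewrite -(ler_nat R) !(natrM, natrX).
rewrite -(ler_pM2r (exprn_gt0 m X0)); apply: (le_trans leR).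
rewrite mulrAC -exprMn; apply: ler_wpM2r; first by rewrite exprn_ge0.
by rewrite lerXn2r ?nnegrE // mulr_ge0 // ltW.
Qed.

(** [G] consists of the [w] for which no vertex of either side is overloaded in any prefix of length
    at least [K0]. The failure probabilities telescope to at most 1 / K0 <= 1/2. *)
Lemma good_weights (eps : R) : 0 < eps <= 1 ->
  exists g K, [/\ (0 < g)%N, (0 < K)%N &
    forall n (h : pred {ffun 'I_k -> 'I_n}) (L : {set 'I_k}) DA DB, (K <= n)%N ->
    (forall x, #|non_extensions h L x| <= DA)%N ->
    (forall x, #|non_extensions h (~: L) x| <= DB)%N ->
    DA%:R / n%:R ^+ #|~: L| + DB%:R / n%:R ^+ #|L| <= 1 - eps ->
  exists2 G : {set {ffun 'I_k -> {perm 'I_n}}}, (n`! ^ k <= 2 * #|G|)%N &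
    forall w t, w \in G -> (K <= t <= n)%N ->
    prefix_good g (fun i s => h (mix L w i s)) t].
Proof.
move=> /andP[e0 e1]; pose eta := eps / 4; pose x := eta / 8.
have eta01 : 0 < eta <= 1 by rewrite /eta; lra.
have x01 : 0 < x <= 1 by rewrite /x /eta; lra.
pose N := (Num.truncn (8 * k.+1%:R / eta)).+1.
have kN : 8 * k.+1%:R <= eta * N%:R.
  by rewrite [leRHS]mulrC -ler_pdivrMr; [apply/ltW/truncnS_gt | lra].
have [K0 K01 tailK] := @geometric_tail R x N x01 isT.
(* With [4 <= eps * g] and [2 * g <= t], the margin eps g t / 2 left by the degrees is at least 2t,
   which covers the terms t and 2g of [prefix_good]. *)
pose g := (Num.truncn (4 / eps)).+1.
have eg : 4 <= eps * g%:R.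
  by rewrite [leRHS]mulrC -ler_pdivrMr //; apply/ltW/truncnS_gt.
exists g, (maxn K0 (2 * g)); split=> // [|n h L DA DB]; first by rewrite leq_max ltnW.
rewrite geq_max => /andP[K0n gn] hA hB hAB.
set pA := DA%:R / _ in hAB *; set pB := DB%:R / _ in hAB *.
have pA0 : 0 <= pA by rewrite /pA divr_ge0 ?exprn_ge0.
have pB0 : 0 <= pB by rewrite /pB divr_ge0 ?exprn_ge0.
pose ovl t i := overloaded h L pA eta t i :|: overloaded h (~: L) pB eta t i.
pose U := \bigcup_(t < n.+1 | (K0 <= t)%N) \bigcup_(i in ~: tail n t) ovl t i.
have cU : #|U|%:R <= \sum_(t < n.+1 | (K0 <= t)%N) (t%:R^-1 - t.+1%:R^-1) * (n`!)%:R ^+ k :> R.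
  apply: (@le_trans _ _ (\sum_(t < n.+1 | (K0 <= t)%N) \sum_(i in ~: tail n t) #|ovl t i|)%:R).
    rewrite ler_nat; apply: leq_trans (leq_card_bigcup _ _) _.
    by apply: leq_sum => t _; apply: leq_card_bigcup.
  rewrite natr_sum; apply: ler_sum => t K0t.
  have tn : (t <= n)%N by rewrite -ltnS.
  apply: (@le_trans _ _ (\sum_(i in ~: tail n t) 2 * ((1 - x) ^+ moment_order N t * (n`!)%:R ^+ k))).
    rewrite natr_sum; apply: ler_sum => i _.
    apply: (@le_trans _ _ (#|overloaded h L pA eta t i| + #|overloaded h (~: L) pB eta t i|)%:R).
      by rewrite ler_nat; apply: (leq_card_setU _ _).1.
    have t0n : (0 < t <= n)%N by rewrite tn andbT; apply: leq_trans K0t; apply: ltnW.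
    have bA := @card_overloaded n h L DA eta N t i eta01 t0n isT kN hA.
    have bB := @card_overloaded n h (~: L) DB eta N t i eta01 t0n isT kN hB.
    rewrite setCK in bB; rewrite natrD mulr_natl mulr2n; apply: lerD; [apply: bA|apply: bB].
      by rewrite -/pA; lra.
    by rewrite -/pB; lra.
  rewrite sumr_const card_tailC // -[_ *+ t]mulr_natl !mulrA [t%:R * 2]mulrC.
  by apply: ler_wpM2r; rewrite ?exprn_ge0 //; apply: tailK.
have {}cU : #|U|%:R <= (n`!)%:R ^+ k / 2 :> R.
  apply: (le_trans cU); rewrite -mulr_suml mulrC; apply: ler_wpM2l; first by rewrite exprn_ge0.
  have telescope : \sum_(K0 <= t < n.+1) (t%:R^-1 - t.+1%:R^-1) = K0%:R^-1 - n.+1%:R^-1 :> R.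
    rewrite (@telescope_sumr_eq _ _ _ (fun t => - t%:R^-1)); first by rewrite opprK addrC.
      by rewrite ltnW.
    by move=> t _; rewrite opprK addrC.
  rewrite big_geq_mkord /= in telescope; rewrite telescope.
  apply: (@le_trans _ _ K0%:R^-1); first by rewrite gerBl invr_ge0.
  by rewrite lef_pV2 ?posrE ?ltr0n ?ler_nat // ltnW.
exists (~: U) => [|w t].
  have cGU : (#|U| + #|~: U| = n`! ^ k)%N.
    by rewrite cardsC card_ffun card_ord card_Sn.
  rewrite -(ler_nat R) natrM -cGU natrD.
  have : #|U|%:R + #|~: U|%:R = (n`!)%:R ^+ k :> R by rewrite -natrD cGU natrX.
  move: cU; lra.
rewrite geq_max => wU /andP[/andP[K0t gt] tn].
have wO i : i \notin tail n t -> w \notin ovl t i.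
  move=> it; move: wU; rewrite in_setC; apply: contra => wo; have ltn1 : (t < n.+1)%N by [].
  apply/bigcupP; exists (Ordinal ltn1) => //; apply/bigcupP; exists i => //.
  by rewrite inE.
(* A vertex that is not overloaded has at most this integer part of missing neighbours; the bound
   for [~: L] handles the second side. *)
exists (Num.truncn ((pA + eta) * t%:R)), (Num.truncn ((pB + eta) * t%:R)); split.
  split=> i /wO; rewrite !inE negb_or -!leqNgt => /andP[oA oB].
    apply: leq_trans oA; apply/subset_leq_card/subsetP => s.
    by rewrite !inE.
  apply: leq_trans oB; apply/subset_leq_card/subsetP => s.
  by rewrite !inE mixC.
rewrite -(ler_nat R) !(natrM, natrD).
have tR : 0 <= t%:R :> R by [].
have tA : (Num.truncn ((pA + eta) * t%:R))%:R <= (pA + eta) * t%:R.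
  by rewrite truncn_le mulr_ge0 //; lra.
have tB : (Num.truncn ((pB + eta) * t%:R))%:R <= (pB + eta) * t%:R.
  by rewrite truncn_le mulr_ge0 //; lra.
have gR : 0 <= g%:R :> R by [].
have g2t : 2 * g%:R <= t%:R :> R by rewrite -natrM ler_nat.
have sum_le : (Num.truncn ((pA + eta) * t%:R))%:R + (Num.truncn ((pB + eta) * t%:R))%:R
    <= (1 - eps / 2) * t%:R.
  apply: le_trans (lerD tA tB) _; rewrite -mulrDl; apply: ler_wpM2r => //.
  by rewrite /eta; lra.
set a := (Num.truncn _)%:R + _ in sum_le *.
have le1 : g%:R * (a + 2) <= g%:R * ((1 - eps / 2) * t%:R + 2).
  by apply: ler_wpM2l => //; rewrite lerD2r.
have le2 : 4 * t%:R <= eps * g%:R * t%:R by apply: ler_wpM2r.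
apply: (@le_trans _ _ (g%:R * ((1 - eps / 2) * t%:R + 2) + t%:R)); first by lra.
have -> : g%:R * ((1 - eps / 2) * t%:R + 2) + t%:R =
  g%:R * t%:R - eps * g%:R * t%:R / 2 + 2 * g%:R + t%:R by ring.
lra.
Qed.

End GoodWeights.

(** * Spread embeddings *)

(** Once some [s0] satisfies the constraints, every solution agrees with [s0] on [p @: A], and
    [expn_fact_le] applies. *)
Lemma card_perm_constraints n (A : {set 'I_n}) (p v : 'I_n -> 'I_n) : injective p ->
  #|[set s : {perm 'I_n} | [forall i in A, s (p i) == v i]]| * n ^ #|A| <= 4 ^ #|A| * n`!.
Proof.
move=> injp; set S := [set s | _].
have leAn : #|A| <= n by rewrite -[n in _ <= n]card_ord max_card.
have [->|[s0]] := set_0Vmem S; first by rewrite cards0.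
rewrite inE => /forall_inP s0A.
apply: leq_trans (expn_fact_le leAn); rewrite mulnC leq_mul2l; apply/orP; right.
rewrite -(card_imset A injp) -[n in n - _]card_ord -(card_perm_agree _ s0).
apply/subset_leq_card/subsetP => s; rewrite !inE => /forall_inP sA.
by apply/forall_inP => _ /imsetP[i iA ->]; rewrite (eqP (sA i iA)) eq_sym s0A.
Qed.

Lemma card_family_set (I T : finType) (F : I -> {set T}) :
  #|[set f : {ffun I -> T} | [forall i, f i \in F i]]| = \prod_i #|F i|.
Proof.
have -> : #|[set f : {ffun I -> T} | [forall i, f i \in F i]]| = #|family F|.
  by apply: eq_card => f; rewrite inE.
by rewrite card_family foldrE big_map big_enum.
Qed.

Section SpreadCount.
Variables (k n : nat) (L : {set 'I_k}) (X : {set 'I_k * 'I_n}) (u : 'I_k * 'I_n -> 'I_n).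
Local Notation W := {ffun 'I_k -> {perm 'I_n}}.

(** An element of [X] is a pair (class, index); the embedding built from [w] and [t] must give that
    vertex the label prescribed by [u]. *)
Definition meets (w : W) (t : {perm 'I_n}) :=
  [forall x in X, mix L w x.2 (t x.2) x.1 == u x].

(** For fixed [t] the constraints separate over the classes: class [j] restricts only [w j], at
    points [i] or [t i] that are distinct. *)
Lemma card_meets_weights t : #|[set w | meets w t]| * n ^ #|X| <= 4 ^ #|X| * n`! ^ k.
Proof.
pose Xj j := [set i | (j, i) \in X].
pose F j := [set s : {perm 'I_n} |
  [forall i in Xj j, s (if j \in L then i else t i) == u (j, i)]].
have -> : [set w | meets w t] = [set w : W | [forall j, w j \in F j]].
  apply/setP => w; rewrite !inE; apply/forall_inP/forallP => [wX j|wF [j i] ji].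
    by rewrite inE; apply/forall_inP => i; rewrite inE => /wX; rewrite !ffunE.
  have := wF j; rewrite inE => /forall_inP/(_ i); rewrite inE ffunE; exact.
rewrite card_family_set (card_set_pair X) !expn_sum.
have -> : n`! ^ k = \prod_(j < k) n`! by rewrite prod_nat_const card_ord.
rewrite -!big_split /=; apply: leq_prod => j _.
apply: (@card_perm_constraints _ (Xj j) (fun i => if j \in L then i else t i) (fun i => u (j, i))).
by move=> a b; case: ifP => // _ /perm_inj.
Qed.

(* Each [t] agrees on [I] with exactly [(n - #|I|)`!] permutations [s], and whether
   the constraints hold depends only on the values on [I]. *)
Lemma card_meets_matchings (w : W) (PM : {set {perm 'I_n}}) c :
    let I := [set i : 'I_n | [exists j : 'I_k, (j \notin L) && ((j, i) \in X)]] in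
    (forall s : {perm 'I_n},
      #|[set t in PM | [forall i in I, t i == s i]]| * n ^ #|I| <= c ^ #|I| * #|PM|) ->
  #|[set t in PM | meets w t]| * ((n - #|I|)`! * n ^ #|I|)
    <= c ^ #|I| * #|PM| * #|[set s | meets w s]|.
Proof.
move=> I spread.
have meets_agree (s t : {perm 'I_n}) : [forall i in I, s i == t i] -> meets w s = meets w t.
  move/forall_inP => ag; apply: eq_forallb_in => -[j i] ji; rewrite !ffunE /=.
  case: ifPn => // jL; rewrite (eqP (ag i _)) // inE.
  by apply/existsP; exists j; rewrite jL.
have agC (s t : {perm 'I_n}) : [forall i in I, s i == t i] = [forall i in I, t i == s i].
  by apply: eq_forallb_in => i _; rewrite eq_sym.
rewrite mulnA -sum_nat_const.
under eq_bigr => t _ do rewrite -[n in n - _]card_ord -(card_perm_agree I t) -sum1_card big_mkcond.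
rewrite exchange_big /= mulnC big_distrr /= [leqRHS]mulnC -sum_nat_const.
rewrite [leqRHS]big_mkcond; apply: leq_sum => s _.
rewrite -big_mkcondr sum1_card mulnC; case: ifPn => ms; last first.
  rewrite eq_card0 // => t; rewrite unfold_in /= !inE agC; apply/negP.
  by case/andP=> /andP[_ mt] /meets_agree mst; move: ms; rewrite inE -mst mt.
apply: leq_trans (spread s); rewrite leq_mul2r; apply/orP; right.
apply/subset_leq_card/subsetP => t; rewrite unfold_in /= !inE agC.
by case/andP=> /andP[-> _] ->.
Qed.

End SpreadCount.

(** The sum is the probability of [meets] for uniform [w] in [G] and then uniform [t] in [PM w].
    Replacing [t] by a uniform permutation costs c^r with r the size of [X]; letting [w] range over
    all tuples costs 2, and then each permutation contributes at most (4/n)^r. As r >= 1, the factor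
    2 fits into (8c)^r. *)
Lemma spread_sum (R : realType) (k n : nat) (L : {set 'I_k}) (X : {set 'I_k * 'I_n})
    (u : 'I_k * 'I_n -> 'I_n) (G : {set {ffun 'I_k -> {perm 'I_n}}})
    (PM : {ffun 'I_k -> {perm 'I_n}} -> {set {perm 'I_n}}) c :
    (0 < n)%N -> (0 < c)%N -> (n`! ^ k <= 2 * #|G|)%N ->
    (forall w, w \in G -> 0 < #|PM w|)%N ->
    (forall w (s : {perm 'I_n}) (I : {set 'I_n}), w \in G ->
      #|[set t in PM w | [forall i in I, t i == s i]]| * n ^ #|I| <= c ^ #|I| * #|PM w|)%N ->
    (0 < #|X|)%N ->
  (\sum_(w in G) #|[set t in PM w | meets L X u w t]|%:R / (#|G|%:R * #|PM w|%:R)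
    <= ((8 * c)%:R / n%:R) ^+ #|X| :> R)%R.
Proof.
move=> n0 c0 leG PM0 spread X0; pose r := #|X|.
pose I := [set i : 'I_n | [exists j : 'I_k, (j \notin L) && ((j, i) \in X)]].
have Ir : #|I| <= r.
  apply: leq_trans (leq_imset_card snd (mem X)); apply/subset_leq_card/subsetP => i.
  rewrite inE => /existsP[j /andP[_ jX]]; apply/imsetP; by exists (j, i).
have In : #|I| <= n by rewrite -[n in _ <= n]card_ord max_card.
pose M w := #|[set s | meets L X u w s]|.
have factI : n`! <= (n - #|I|)`! * n ^ #|I|.
  rewrite -(ffact_fact In) mulnC leq_mul2l; apply/orP; right.
  rewrite ffact_prod -[X in _ ^ X]card_ord -prod_nat_const.
  by apply: leq_prod => i _; apply: leq_subr.
have leM w : w \in G ->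
    #|[set t in PM w | meets L X u w t]| * n`! <= c ^ r * #|PM w| * M w.
  move=> wG; apply: leq_trans (leq_mul (leqnn _) factI) _.
  apply: leq_trans (@card_meets_matchings _ _ L X u w (PM w) c _) _.
    by move=> s; apply: spread.
  by rewrite !leq_mul // leq_pexp2l.
have sumM : (\sum_(w in G) M w) * n ^ r <= n`! * (4 ^ r * n`! ^ k).
  apply: (@leq_trans ((\sum_w M w) * n ^ r)).
    by rewrite leq_mul2r; apply/orP; right; rewrite [leqRHS](bigID (mem G)) leq_addr.
  rewrite /M; under eq_bigr => w _ do rewrite -sum1dep_card big_mkcond.
  rewrite exchange_big /= big_distrl /=.
  rewrite -[n`! in leqRHS]card_Sn -sum_nat_const; apply: leq_sum => s _; rewrite card_Sn.
  apply: leq_trans (card_meets_weights L X u s); rewrite leq_mul2r; apply/orP; right.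
  by rewrite -big_mkcond sum1dep_card.
have G0 : 0 < #|G|.
  have : 0 < 2 * #|G| by apply: leq_trans leG; rewrite expn_gt0 fact_gt0.
  by rewrite muln_gt0.
have GR : (0 < #|G|%:R :> R)%R by rewrite ltr0n.
have FR : (0 < (n`!)%:R :> R)%R by rewrite ltr0n fact_gt0.
have nrR : (0 < n%:R ^+ r :> R)%R by rewrite exprn_gt0 // ltr0n.
apply: (@le_trans _ _ (\sum_(w in G) ((c ^ r)%:R / ((n`!)%:R * #|G|%:R) * (M w)%:R))%R).
  apply: ler_sum => w wG; have PR : (0 < #|PM w|%:R :> R)%R by rewrite ltr0n PM0.
  rewrite ler_pdivrMr ?mulr_gt0 //.
  have := leM w wG; rewrite -(ler_nat R) !natrM => le_w.
  rewrite -(ler_pM2r FR); apply: (le_trans le_w).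
  by rewrite le_eqVlt; apply/orP; left; apply/eqP; field; rewrite !gt_eqF //.
rewrite -mulr_sumr -natr_sum expr_div_n -natrX -/r.
have sumR : ((\sum_(w in G) M w)%:R <= (n`!)%:R * ((4 ^ r)%:R * (2 * #|G|)%:R) / n%:R ^+ r :> R)%R.
  rewrite ler_pdivlMr // -natrX -!natrM ler_nat; apply: (leq_trans sumM).
  by rewrite leq_mul2l leq_mul2l leG !orbT.
have cR : (0 <= (c ^ r)%:R / ((n`!)%:R * #|G|%:R) :> R)%R by rewrite divr_ge0 ?mulr_ge0.
apply: (le_trans (ler_wpM2l cR sumR)).
have -> : ((c ^ r)%:R / ((n`!)%:R * #|G|%:R)
    * ((n`!)%:R * ((4 ^ r)%:R * (2 * #|G|)%:R) / n%:R ^+ r)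
  = (2 * (c ^ r) * 4 ^ r)%:R / n%:R ^+ r :> R)%R.
  by rewrite !natrM; field; rewrite !gt_eqF //.
apply: ler_wpM2r; first by rewrite invr_ge0 ltW.
rewrite ler_nat (_ : 8 = 2 * 4) // !expnMn mulnAC leq_mul2r leq_mul2r.
by rewrite -[leqLHS]expn1 leq_pexp2l ?orbT.
Qed.

(** * Encoding vertices and edges by labels *)

Lemma enum_parts (V : finType) k n (P : 'I_k -> {set V}) : (forall j, #|P j| = n) ->
  exists v : 'I_k -> 'I_n -> V, [/\ forall j i, v j i \in P j, forall j, injective (v j)
    & forall j x, x \in P j -> exists i, x = v j i].
Proof.
move=> cP; exists (fun j i => enum_val (cast_ord (esym (cP j)) i)); split=> [j i|j|j x xP].
- exact: enum_valP.
- by move=> a b /enum_val_inj /cast_ord_inj.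
- exists (cast_ord (cP j) (enum_rank_in xP x)).
  by rewrite cast_ordK enum_rankK_in.
Qed.

Section Encoding.
Variables (V : finType) (k n : nat) (P : 'I_k -> {set V}) (H : hypergraph V).
Hypothesis kp : kpartite P H.
Variable v : 'I_k -> 'I_n -> V.
Hypotheses (vP : forall j i, v j i \in P j) (v_inj : forall j, injective (v j))
  (v_surj : forall j x, x \in P j -> exists i, x = v j i).

Definition transversal (f : {ffun 'I_k -> 'I_n}) : {set V} := [set v j (f j) | j : 'I_k].

Definition spans_edge f := transversal f \in H.

Lemma part_unique j j' x : x \in P j -> x \in P j' -> j = j'.
Proof.
move=> xj xj'; apply/eqP/negPn/negP => /(parts_disjoint kp) /pred0P/(_ x).
by rewrite /= xj xj'.
Qed.

Lemma v_inj2 j j' i i' : v j i = v j' i' -> j = j' /\ i = i'.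
Proof.
move=> eqv; have eqj : j = j' by apply: (@part_unique _ _ (v j i)); rewrite // eqv.
by subst j'; split=> //; apply: v_inj eqv.
Qed.

Lemma edge_vertex e j : e \in H -> exists i, forall i', (v j i' \in e) = (i' == i).
Proof.
move=> eH; have /eqP/cards1P[x ex] := edge_transversal kp eH j.
have : x \in e :&: P j by rewrite ex set11.
rewrite inE => /andP[xe /v_surj[i xi]]; exists i => i'.
have -> : (v j i' \in e) = (v j i' \in e :&: P j) by rewrite inE vP andbT.
by rewrite ex inE xi (inj_eq (@v_inj j)).
Qed.

Lemma edge_is_transversal e : e \in H -> exists f, e = transversal f.
Proof.
move=> eH; have [f0 f0E] := fin_all_exists (fun j => edge_vertex j eH).
pose f := finfun f0; have fE j i : (v j i \in e) = (i == f j) by rewrite ffunE f0E.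
exists f; apply/setP => x; apply/idP/imsetP => [xe|[j _ ->]]; last by rewrite fE.
have /bigcupP[j _ /v_surj[i xi]] : x \in \bigcup_j P j by rewrite (parts_cover kp) inE.
by exists j => //; move: xe; rewrite xi fE => /eqP ->.
Qed.

(** Among the [n ^ #|~: L|] tuples extending [x] from [L], those spanning an edge are at least as
    many as the neighbours of [X], since each neighbour is the rest of such an edge. *)
Lemma min_degree_non_extensions (L : {set 'I_k}) x :
  min_degree P H L + #|non_extensions spans_edge L x| <= n ^ #|~: L|.
Proof.
pose X := [set v j (x j) | j in L].
have vx_inj : injective (fun j => v j (x j)) by move=> j j' /v_inj2[].
have legX : legal_set P L X.
  rewrite /legal_set card_imset // eqxx /=; apply/forall_inP => j jL.
  apply/cards1P; exists (v j (x j)); apply/setP => y; rewrite !inE.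
  apply/andP/eqP => [[/imsetP[j' _ ->] yj]|->]; last by rewrite imset_f.
  by rewrite (part_unique (vP _ _) yj).
pose ext := [set f : {ffun 'I_k -> 'I_n} | [forall j in L, f j == x j]].
have cext : #|ext| = n ^ #|~: L|.
  pose F j := if j \in L then [set x j] else [set: 'I_n].
  have -> : ext = [set f : {ffun 'I_k -> 'I_n} | [forall j, f j \in F j]].
    apply/setP => f; rewrite !inE; apply: eq_forallb => j; rewrite /F.
    by case: (j \in L); rewrite inE.
  rewrite card_family_set (bigID (mem L)) /= big1 ?mul1n => [|j jL]; last by rewrite /F jL cards1.
  rewrite -[in RHS](card_ord n) -prod_nat_const; apply: eq_big => j; first by rewrite inE.
  by rewrite /F => /negbTE ->; rewrite cardsT.
have cnb : #|nbhd H X| <= #|[set f in ext | spans_edge f]|.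
  apply: leq_trans (leq_imset_card (fun f => transversal f :\: X) _).
  apply/subset_leq_card/subsetP => Y; rewrite inE => /andP[YX XYH].
  have [f ef] := edge_is_transversal XYH; apply/imsetP; exists f.
    rewrite !inE /spans_edge -ef XYH andbT; apply/forall_inP => j jL.
    have : v j (x j) \in transversal f by rewrite -ef inE imset_f.
    by case/imsetP => j' _ /v_inj2[-> ->].
  rewrite -ef; apply/setP => y; rewrite !inE.
  by have := subsetP YX y; rewrite inE; case: (y \in Y) => [/(_ isT) ->|_]; case: (y \in X).
apply: (@leq_trans (#|[set f in ext | spans_edge f]| + #|non_extensions spans_edge L x|)).
  by rewrite leq_add2r; apply: leq_trans cnb; apply: min_degree_le.
rewrite -cext -[X in _ <= X](cardsID [set f | spans_edge f]) leq_add //.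
  by apply/subset_leq_card/subsetP => f; rewrite !inE.
by apply/subset_leq_card/subsetP => f; rewrite !inE andbC.
Qed.

Definition matching_map (L : {set 'I_k}) (w : {ffun 'I_k -> {perm 'I_n}}) (t : {perm 'I_n}) :
    {ffun 'I_n * 'I_k -> V} :=
  [ffun p => v p.2 (mix L w p.1 (t p.1) p.2)].

Lemma matching_map_embedding L w (t : {perm 'I_n}) :
  t \in matchings (fun i s => spans_edge (mix L w i s)) 1%g set0 ->
  is_embedding (perfect_matching n k) H (matching_map L w t).
Proof.
move=> /matchingsP[_ tB]; apply/andP; split.
  apply/injectiveP => -[i j] [i' j']; rewrite !ffunE /= => /v_inj2[<-].
  by case: ifP => _ /perm_inj; [move=> -> | move=> /perm_inj ->].
apply/forall_inP => _ /imsetP[i _ ->].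
have := tB i; rewrite inE => /(_ isT); rewrite /spans_edge; congr (_ \in H).
rewrite -imset_comp; apply: eq_imset => j.
by rewrite [RHS]ffunE.
Qed.

End Encoding.

(** * The random embedding *)

Lemma pushforward_distribution (R : realType) (S T : finType) (F : S -> T) (p : S -> R) :
    (forall s, 0 <= p s)%R -> (\sum_s p s = 1)%R ->
  exists mu : distribution R T, forall A, (prob mu A = \sum_(s | F s \in A) p s)%R.
Proof.
move=> p0 p1; pose q t := (\sum_(s | F s == t) p s)%R.
have q0 t : (0 <= q t)%R by apply: sumr_ge0.
have q1 : (\sum_t q t = 1)%R by rewrite -p1 (partition_big F predT).
exists (Distribution q0 q1) => A; rewrite /prob /= (partition_big F (mem A)) //=.
apply: eq_bigr => t tA; apply: eq_bigl => s.
by case: eqP => [->|]; rewrite ?andbF // tA.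
Qed.

Local Open Scope ring_scope.

Theorem theorem2p7 (R : realType) (eps : R) (heps : 0 < eps) (k : nat) :
  exists2 C : R, 0 < C &
  forall l : nat, (1 <= l <= k.-1)%N ->
  exists n0 : nat, forall n : nat, (n0 <= n)%N ->
  forall (L : {set 'I_k}), #|L| = l ->
  forall (V : finType) (P : 'I_k -> {set V}) (H : hypergraph V),
    kpartite P H ->
    (forall i, #|P i| = n) ->
    (min_degree P H L)%:R * n%:R ^+ l
      + (min_degree P H (~: L))%:R * n%:R ^+ (k - l)
      >= (1 + eps) * n%:R ^+ k ->
  exists mu : distribution R (embedding (perfect_matching n k) H),
    vertex_spread (C / n%:R) mu.
Proof.
(* [good_weights] assumes its parameter to be at most 1; the degree condition for [eps] implies the
   one for [eps']. *)
pose eps' := Num.min eps 1.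
have eps01 : 0 < eps' <= 1 by rewrite lt_min heps ltr01 ge_min lexx orbT.
have [g [K [g0 K0 good]]] := @good_weights R k eps' eps01.
pose c := spread_const g K; exists (8 * c)%:R.
  by rewrite ltr0n !muln_gt0 !expn_gt0 fact_gt0 g0.
(* The bound [8 * c <= n] puts C / n in [0, 1], as [vertex_spread] demands. *)
move=> l _; exists (maxn K (8 * c)) => n; rewrite geq_max => /andP[Kn cn].
move=> L cL V P H kp cP hdeg.
have n0 : (0 < n)%N by apply: leq_trans Kn.
have nR : 0 < n%:R :> R by rewrite ltr0n.
have [v [vP v_inj v_surj]] := enum_parts cP.
pose h := spans_edge H v.
have cLC : #|~: L| = (k - l)%N by rewrite cardsCs setCK card_ord cL.
have lk : (l <= k)%N by rewrite -cL -[k in (_ <= k)%N]card_ord max_card.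
have degA x := min_degree_non_extensions kp vP v_inj v_surj L x.
have degB x := min_degree_non_extensions kp vP v_inj v_surj (~: L) x.
rewrite setCK in degB.
pose x0 : {ffun 'I_k -> 'I_n} := [ffun=> Ordinal n0].
have dA : (min_degree P H L <= n ^ #|~: L|)%N := leq_trans (leq_addr _ _) (degA x0).
have dB : (min_degree P H (~: L) <= n ^ #|L|)%N := leq_trans (leq_addr _ _) (degB x0).
have [|||G leG goodG] := good n h L (n ^ #|~: L| - min_degree P H L)%N
    (n ^ #|L| - min_degree P H (~: L))%N Kn.
- by move=> x; rewrite leq_subRL // degA.
- by move=> x; rewrite leq_subRL // degB.
- rewrite !natrB // !natrX !mulrBl !divff ?expf_neq0 ?gt_eqF // cLC cL.
  have nk : n%:R ^+ k = n%:R ^+ l * n%:R ^+ (k - l) :> R by rewrite -exprD subnKC.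
  have nl : 0 < n%:R ^+ l :> R by rewrite exprn_gt0.
  have nkl : 0 < n%:R ^+ (k - l) :> R by rewrite exprn_gt0.
  have : (1 + eps) <= (min_degree P H L)%:R / n%:R ^+ (k - l)
                      + (min_degree P H (~: L))%:R / n%:R ^+ l :> R.
    rewrite -(ler_pM2r (exprn_gt0 k nR)); apply: (le_trans hdeg).
    by rewrite nk le_eqVlt; apply/orP; left; apply/eqP; field; rewrite !gt_eqF.
  have : eps' <= eps by rewrite ge_min lexx.
  lra.
pose PM (w : {ffun 'I_k -> {perm 'I_n}}) : {set {perm 'I_n}} :=
  matchings (fun i s => h (mix L w i s)) 1%g set0.
have goodPM w t : w \in G -> (K <= t <= n)%N -> prefix_good g (fun i s => h (mix L w i s)) t.
  exact: goodG.
have PM0 w : w \in G -> (0 < #|PM w|)%N.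
  by move=> wG; apply: (PM_gt0 g0 K0 (goodPM w ^~ wG) Kn).
have PMs w (s : {perm 'I_n}) (I : {set 'I_n}) : w \in G ->
    (#|[set t in PM w | [forall i in I, t i == s i]]| * n ^ #|I| <= c ^ #|I| * #|PM w|)%N.
  by move=> wG; apply: (PM_spread g0 K0 (goodPM w ^~ wG) Kn).
have G0 : (0 < #|G|)%N.
  have : (0 < 2 * #|G|)%N by apply: leq_trans leG; rewrite expn_gt0 fact_gt0.
  by rewrite muln_gt0.
have [w0 w0G] := card_gt0P G0; have [t0 t0PM] := card_gt0P (PM0 w0 w0G).
(* A default for [insubd], never reached where the weight [p] is positive. *)
pose emb0 : embedding (perfect_matching n k) H :=
  exist (is_embedding (perfect_matching n k) H) _ (matching_map_embedding kp vP v_inj t0PM).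
pose F (s : {ffun 'I_k -> {perm 'I_n}} * {perm 'I_n}) := insubd emb0 (matching_map v L s.1 s.2).
pose p (s : {ffun 'I_k -> {perm 'I_n}} * {perm 'I_n}) : R :=
  if (s.1 \in G) && (s.2 \in PM s.1) then (#|G|%:R * #|PM s.1|%:R)^-1 else 0.
have sum_p A : \sum_(s | F s \in A) p s =
    \sum_(w in G) #|[set t in PM w | F (w, t) \in A]|%:R / (#|G|%:R * #|PM w|%:R).
  rewrite big_mkcond /=.
  transitivity (\sum_w \sum_t (if F (w, t) \in A then p (w, t) else 0)).
    by rewrite pair_bigA; apply: eq_bigr => -[w t] _.
  rewrite [RHS]big_mkcond /=; apply: eq_bigr => w _; rewrite -big_mkcond /p /=.
  case: (w \in G); last by rewrite big1.
  rewrite -big_mkcondr /= sumr_const [RHS]mulr_natl; congr (_ *+ _).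
  by apply: eq_card => t; rewrite [RHS]inE unfold_in /= andbC.
have p0 s : 0 <= p s.
  by rewrite /p; case: ifP => // _; rewrite invr_ge0 mulr_ge0.
have p1 : \sum_s p s = 1.
  transitivity (\sum_(s | F s \in setT) p s); first by apply: eq_bigl => s; rewrite inE.
  rewrite sum_p (eq_bigr (fun=> #|G|%:R^-1)) => [|w wG].
    by rewrite sumr_const -[_ *+ _]mulr_natl divff // pnatr_eq0 -lt0n.
  have -> : [set t in PM w | F (w, t) \in setT] = PM w.
    by apply/setP => t; rewrite [LHS]inE in_setT andbT.
  by rewrite invfM mulrCA divff ?mulr1 // pnatr_eq0 -lt0n PM0.
have [mu muE] := @pushforward_distribution R _ _ F p p0 p1.
exists mu; split.
  by rewrite divr_ge0 //= ler_pdivrMr // mul1r ler_nat.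
move=> r x y ux uy; set A := [set phi | _]; rewrite muE.
(* The empty prescription is set apart because [spread_sum] needs a nonempty [X]. *)
have [r0|r0] := posnP r.
  rewrite r0 expr0 -p1 [leRHS](bigID (fun s => F s \in A)) /= lerDl.
  exact: sumr_ge0.
rewrite sum_p.
pose X := [set (q.2, q.1) | q in x].
have cX : #|X| = r.
  rewrite card_imset => [|[i j] [i' j'] /= [-> ->]] //.
  by rewrite (card_uniqP ux) size_tuple.
pose i0 := Ordinal n0.
(* If a prescribed image lies outside its class, no matching in the support realises it, so the
   default label is harmless. *)
pose u (q : 'I_k * 'I_n) := odflt i0
  [pick i | v q.1 i == nth (v q.1 i0) y (index (q.2, q.1) x)].
have FE w t : t \in PM w -> val (F (w, t)) = matching_map v L w t.
  by move=> tPM; rewrite insubdK //; apply: (matching_map_embedding kp vP v_inj).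
rewrite -cX; apply: le_trans (@spread_sum R k n L X u G PM c n0 _ leG PM0 _ _); last first.
- by rewrite cX.
- by move=> w s I wG; apply: PMs.
- by rewrite !muln_gt0 !expn_gt0 fact_gt0 g0.
apply: ler_sum => w wG; apply: ler_wpM2r; first by rewrite invr_ge0 mulr_ge0.
rewrite ler_nat; apply/subset_leq_card/subsetP => t.
rewrite [t \in _]inE => /andP[tPM FA]; rewrite [t \in _]inE tPM /=.
move: FA; rewrite inE FE // => /forallP phiP.
apply/forall_inP => _ /imsetP[q qx ->] /=; case: q qx => i j qx /=.
have lt_q : (index (i, j) x < r)%N by rewrite -[r in (_ < r)%N](size_tuple x) index_mem.
have := phiP (Ordinal lt_q).
rewrite (tnth_nth (i, j)) (tnth_nth (v j i0)) /= nth_index // ffunE /= => /eqP vE.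
rewrite /u /= -vE; case: pickP => [i' /eqP /v_inj -> //|/(_ (mix L w i (t i) j))].
by rewrite eqxx.
Qed.
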